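(* Let $n\ge 0$ and $0\le i\le\lfloor n/2\rfloor$ be integers. Then for every integer $r\ge 0$, \[\sum_{\substack{0\le j,k\le i\\ j+k=r}}\binom{n-2j}{i-j}\binom{n-2k}{i-k}\;\ge\;\sum_{\substack{0\le j,k\le i+1\\ j+k=r}}\binom{n-2j}{i-1-j}\binom{n-2k}{i+1-k}.\]
   Context: For integers $a,b$, the binomial coefficient $\binom{a}{b}$ is the usual one when $0\le b\le a$ and is taken to be $0$ otherwise (in particular whenever $b<0$, $b>a$, or $a<0$); equivalently $\binom{a}{b}$ counts north-east lattice paths from $(0,0)$ to $(a-b,b)$. *)

(* Defs.v *)
From mathcomp Require Import all_boot all_order all_algebra.

Set Implicit Arguments.
Unset Strict Implicit.
Unset Printing Implicit Defensive.

Import Order.TTheory GRing.Theory Num.Theory.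

(* The arguments are signed because the truncated subtraction of nat would turn
   a vanishing coefficient with a negative entry into 'C(0, 0) = 1. *)
Definition binz (a b : int) : nat :=
  if (0 <= b <= a)%R then 'C(`|a|%N, `|b|%N) else 0.

(* Main.v *)
(* Let f_(n,i) be the polynomial in q whose coefficient of q^j is C(n-2j, i-j).
   The theorem compares the coefficients of q^r in f_(n,i)^2 and in
   f_(n,i-1) f_(n,i+1). By Pascal's rule
     f_(n+1,i) = f_(n,i) + f_(n,i-1) + [n + 1 = 2i] q^i,
   and we show by induction on n that
     D_n(i,j) = f_(n,i) f_(n,j) - f_(n,i-1) f_(n,j+1)
   has nonnegative coefficients for i <= j <= n/2. Without the extra term,
     D_(n+1)(i,j) = D_n(i,j) + D_n(i,j-1) + D_n(i-1,j) + D_n(i-1,j-1);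
   for j = n/2 the claim is unimodality. The extra term only matters for
   n + 1 = 2(m+1) and j = m, where, as f_(n,m+1) = f_(n,m), one needs
     (f_(n,i) - f_(n,i-2)) f_(n,m) >= q^(m+1) f_(n+1,i-1)
   coefficientwise. There the coefficients of q^(m+1) and above agree on both
   sides, by a convolution identity for the central binomials C(2p+1, p). *)
Require Import Defs.
From mathcomp Require Import all_boot all_order all_algebra.
From mathcomp Require Import zify ring.

Set Implicit Arguments.
Unset Strict Implicit.
Unset Printing Implicit Defensive.

Import Order.TTheory GRing.Theory Num.Theory.
Local Open Scope ring_scope.

(** * Binomial coefficients with signed entries *)

Lemma binz0 (a b : int) : ~~ (0 <= b <= a) -> binz a b = 0%N.
Proof. by rewrite /binz; case: ifP. Qed.

Lemma binzE (a b : nat) : binz a%:Z b%:Z = 'C(a, b).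
Proof.
rewrite /binz; case: ifP => //= h.
by rewrite bin_small //; lia.
Qed.

(** The correction accounts for ['C(0, 0) = 1], whose two parents in row -1 are set to 0. *)
Lemma binzS (a b : int) :
  binz (a + 1) b = (binz a b + binz a (b - 1)%R + ((a == -1)%R && (b == 0)%R))%N.
Proof.
case: (ltP b 0) => [b0|b0].
  by rewrite !binz0 //; lia.
case: (ltP a 0) => [a0|a0].
  have [->|a1] := eqVneq a (-1).
    have [->|bn] := eqVneq b 0; first by [].
    by rewrite !binz0 //; lia.
  by rewrite !binz0 //; lia.
have [a' ea] : exists a' : nat, a = a' by exists `|a|%N; lia.
have [[|b'] eb] : exists b' : nat, b = b' by exists `|b|%N; lia.
  by subst; rewrite (@binz0 _ (0%:Z-1)) // -PoszD !binzE !bin0; lia.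
subst; rewrite -PoszD (_ : b'.+1%:Z - 1 = b'); last lia.
by rewrite !binzE addn1 binS; lia.
Qed.

Lemma binzSn (a : nat) (b : int) :
  binz a.+1%:Z b = (binz a%:Z b + binz a%:Z (b - 1)%R)%N.
Proof. by rewrite (_ : a.+1%:Z = a%:Z + 1) ?binzS ?addn0; lia. Qed.

Lemma binz_pred_le (a b : int) : 2 * b <= a + 1 -> (binz a (b - 1)%R <= binz a b)%N.
Proof.
move=> h; case: (boolP (0 <= b - 1 <= a)) => h1; last by rewrite binz0.
have [a' ea] : exists a' : nat, a = a' by exists `|a|%N; lia.
have [b' eb] : exists b' : nat, b = b'.+1%:Z by exists `|b - 1|%N; lia.
subst; rewrite (_ : b'.+1%:Z - 1 = b'); last lia.
rewrite !binzE -(leq_pmul2l (ltn0Sn b')) mul_bin_left leq_mul2r; lia.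
Qed.

Lemma binz_succ_le (a b : int) : a <= 2 * b + 1 -> (binz a (b + 1)%R <= binz a b)%N.
Proof.
move=> h; case: (boolP (0 <= b + 1 <= a)) => h1; last by rewrite binz0.
have [a' ea] : exists a' : nat, a = a' by exists `|a|%N; lia.
have [b' eb] : exists b' : nat, b = b'%:Z by exists `|b|%N; lia.
subst; rewrite (_ : b'%:Z + 1 = b'.+1); last lia.
rewrite !binzE -(leq_pmul2l (ltn0Sn b')) mul_bin_left leq_mul2r; lia.
Qed.

(** * The polynomials f_(n,i) and coefficientwise positivity *)

Definition diag_gf (n : nat) (i : int) : {poly int} :=
  \poly_(j < `|i|.+1) (binz (n%:Z - 2 * j%:Z) (i - j%:Z))%:Z.

Lemma coef_diag_gf n i j :
  (diag_gf n i)`_j = (binz (n%:Z - 2 * j%:Z) (i - j%:Z))%:Z.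
Proof. by rewrite coef_poly; case: ltnP => // h; rewrite binz0 //; lia. Qed.

Lemma diag_gf_poly n i N : i < N%:Z ->
  diag_gf n i = \poly_(j < N) (binz (n%:Z - 2 * j%:Z) (i - j%:Z))%:Z.
Proof.
move=> iN; apply/polyP => j; rewrite coef_diag_gf coef_poly.
by case: ltnP => // h; rewrite binz0 //; lia.
Qed.

(** The correction of [binzS] occurs only at [j = i], and only when n + 1 = 2i. *)
Lemma diag_gfS n i :
  diag_gf n.+1 i = diag_gf n i + diag_gf n (i - 1)
                   + (if n.+1%:Z == 2 * i then 'X^`|i| else 0).
Proof.
apply/polyP => j; rewrite !coefD !coef_diag_gf.
rewrite (_ : n.+1%:Z - _ = (n%:Z - 2 * j%:Z) + 1); last lia.
rewrite binzS (_ : i - j%:Z - 1 = i - 1 - j%:Z); last lia.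
by case: ifP => e; rewrite ?coefXn ?coef0; lia.
Qed.

Definition coef_ge0 (p : {poly int}) := forall k, 0 <= p`_k.

Lemma coef_ge0D p q : coef_ge0 p -> coef_ge0 q -> coef_ge0 (p + q).
Proof. by move=> hp hq k; rewrite coefD addr_ge0. Qed.

Lemma coef_ge0M p q : coef_ge0 p -> coef_ge0 q -> coef_ge0 (p * q).
Proof. by move=> hp hq k; rewrite coefM sumr_ge0 // => j _; rewrite mulr_ge0. Qed.

Lemma diag_gf_ge0 n i : coef_ge0 (diag_gf n i).
Proof. by move=> j; rewrite coef_diag_gf. Qed.

Lemma coefM_poly (A B : nat -> int) N r :
  (\poly_(j < N) A j * \poly_(k < N) B k)`_r
  = \sum_(0 <= j < N) \sum_(0 <= k < N | (j + k == r)%N) A j * B k.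
Proof.
rewrite !poly_def mulr_suml coef_sum big_mkord; apply: eq_bigr => j _.
rewrite mulr_sumr coef_sum big_mkord [RHS]big_mkcond; apply: eq_bigr => k _.
rewrite -scalerAl -scalerAr scalerA -exprD coefZ coefXn eq_sym.
by case: eqP; rewrite ?mulr1 ?mulr0.
Qed.

(** * A convolution identity for C(2p+1, p) *)

(* x^P * half_row P is the remainder left when (1 + x)^(2P) is divided by 1 - x
   along the powers x^p (1 + x)^(2(P-1-p)): the upper half of the row 2P + 1 of
   Pascal's triangle. *)
Definition half_row (R : nzRingType) (P : nat) : {poly R} :=
  \poly_(k < P.+1) (binz (2 * P).+1%:Z (P%:Z - k%:Z))%:R.

Lemma coef_half_row (R : nzRingType) P k :
  (half_row R P)`_k = (binz (2 * P).+1%:Z (P%:Z - k%:Z))%:R.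
Proof. by rewrite coef_poly; case: ltnP => // h; rewrite binz0 //; lia. Qed.

(** The factor [(1 + 'X) ^+ 2] performs two Pascal steps, from row 2P+1 to row 2P+3. The term in
    [1 - 'X] repairs the edge where the row is cut, using C(2P+1, P+1) = C(2P+1, P). *)
Lemma half_rowS (R : comNzRingType) P :
  (1 + 'X) ^+ 2 * half_row R P
  = 'C((2 * P).+1, P)%:R *: (1 - 'X) + 'X * half_row R P.+1.
Proof.
have B2 (k : int) : binz (2 * P.+1).+1%:Z (k + 1) =
    (binz (2 * P).+1%:Z (k + 1)%R + (binz (2 * P).+1%:Z k).*2
     + binz (2 * P).+1%:Z (k - 1)%R)%N.
  by rewrite (_ : (2 * P.+1).+1 = (2 * P).+3) ?binzSn ?addrK; lia.
rewrite (_ : (1 + 'X) ^+ 2 = 1 + ('X + 'X) + 'X * 'X); last by ring.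
apply/polyP => k.
rewrite !mulrDl mul1r -mulrA !coefD !coefXM coefZ coefB coef1 coefX.
rewrite !coef_half_row; case: k => [|[|k]] /=.
- by rewrite -binzE !addr0 !subr0 mulr1.
- rewrite -binzE; have -> : P.+1%:Z - 0%:Z = P%:Z + 1 by lia.
  rewrite B2 !subr0 (_ : binz _ (P%:Z + 1) = binz (2 * P).+1%:Z P%:Z); last first.
    rewrite (_ : P%:Z + 1 = P.+1%:Z) ?binzE; last lia.
    by rewrite -bin_sub; [congr 'C(_, _); lia|lia].
  by rewrite -addnn !natrD; ring.
- have -> : P.+1%:Z - k.+1%:Z = P%:Z - k.+1%:Z + 1 by lia.
  rewrite B2 (_ : P%:Z - k.+1%:Z + 1 = P%:Z - k%:Z); last lia.
  rewrite (_ : P%:Z - k.+1%:Z - 1 = P%:Z - k.+2%:Z); last lia.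
  by rewrite -addnn !natrD; ring.
Qed.

Lemma expr1X_half_row (R : comNzRingType) P :
  (1 + 'X) ^+ (2 * P) =
    \sum_(p < P) 'C((2 * p).+1, p)%:R *:
                   ('X^p * (1 - 'X) * (1 + 'X) ^+ (2 * (P.-1 - p)))
    + 'X^P * half_row R P.
Proof.
elim: P => [|P IH].
  rewrite big_ord0 add0r !mul1r; apply/polyP => k.
  by rewrite coef_half_row coef1; case: k.
rewrite mulnS exprD IH mulrDr mulrCA half_rowS mulrDr mulrA -exprSr addrA.
congr (_ + _); rewrite big_ord_recr /= subnn muln0 expr0 mulr1 scalerAr.
congr (_ + _); rewrite mulr_sumr; apply: eq_bigr => p _.
rewrite -scalerAr mulrCA -exprD; congr (_ *: (_ * _ ^+ _)).
by have := ltn_ord p; lia.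
Qed.

Lemma coef_expr1X (R : comNzRingType) M k :
  ((1 + 'X : {poly R}) ^+ M)`_k = 'C(M, k)%:R.
Proof.
rewrite addrC exprD1n coef_sum; case: (ltnP k M.+1) => [kM|Mk].
  rewrite (bigD1 (Ordinal kM)) //= coefMn coefXn eqxx big1 ?addr0 // => j jk.
  rewrite coefMn coefXn; case: eqP => [e|_]; last by rewrite mul0rn.
  by case/eqP: jk; apply: val_inj.
rewrite big1 ?bin_small // => j _; rewrite coefMn coefXn.
by case: eqP => [e|_]; [have := ltn_ord j; lia|rewrite mul0rn].
Qed.

(* Formally sum_p C(2p+1, p) z^p = (1 + x)^2 / (1 - x) at z = x / (1 + x)^2; the
   identity is the coefficient of x^s after multiplying by (1 - x^2)(1 + x)^(M-3). *)
Lemma sum_bin_convolution (M s : nat) : (2 * s + 3 <= M)%N ->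
  \sum_(p < s.+1) 'C((2 * p).+1, p)%:Z
     * ((binz (M%:Z - 3 - 2 * p%:Z) (s%:Z - p%:Z))%:Z
        - (binz (M%:Z - 3 - 2 * p%:Z) (s%:Z - p%:Z - 2))%:Z)
  = 'C(M, s)%:Z.
Proof.
move=> sM; rewrite -[RHS]natz -coef_expr1X.
(* Expanding the second factor with P = s + 1 leaves a remainder divisible by ['X^(s.+1)], which
   does not reach the coefficient of ['X^s]. *)
rewrite [in RHS](_ : M = (M - 2 * s.+1) + 2 * s.+1)%N; last lia.
rewrite exprD expr1X_half_row mulrDr coefD mulrCA coefXnM ltnSn addr0.
rewrite mulr_sumr coef_sum; apply: eq_bigr => p _.
rewrite -scalerAr coefZ (natz 'C(_, _)); congr (_ * _).
have ps := ltn_ord p.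
rewrite mulrCA -mulrA -exprD coefXnM ltnNge -ltnS ps /=.
have [K eK] : exists K, M = (K + 3 + 2 * p)%N by exists (M - 3 - 2 * p)%N; lia.
rewrite (_ : (_ + _)%N = K.+1); last lia.
(* One spare factor [1 + 'X] turns [1 - 'X] into 1 - x^2, whence a difference of binomials two
   places apart. *)
rewrite exprS mulrA (_ : (1 - 'X) * (1 + 'X) = 1 - 'X * 'X); last by ring.
rewrite mulrBl mul1r coefB -mulrA !coefXM !coef_expr1X.
rewrite (_ : M%:Z - 3 - 2 * (p : nat)%:Z = K%:Z); last lia.
have -> : s%:Z - (p : nat)%:Z = (s - p)%N%:Z by lia.
rewrite binzE (natz 'C(_, _)); congr (_ - _); case: (s - p)%N => [|[|t]] //=.
by rewrite (natz 'C(_, _)) (_ : t.+2%:Z - 2 = t%:Z) ?binzE //; lia.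
Qed.

(** * Coefficientwise inequalities between the f_(n,i) *)

Lemma diag_gf_pred_le n i : 2 * i <= n%:Z + 1 ->
  coef_ge0 (diag_gf n i - diag_gf n (i - 1)).
Proof.
move=> h j; rewrite coefB !coef_diag_gf subr_ge0.
by rewrite lez_nat (_ : i - 1 - j%:Z = i - j%:Z - 1) ?binz_pred_le; lia.
Qed.

Lemma diag_gf_succ_le n i : n%:Z <= 2 * i + 1 ->
  coef_ge0 (diag_gf n i - diag_gf n (i + 1)).
Proof.
move=> h j; rewrite coefB !coef_diag_gf subr_ge0.
by rewrite lez_nat (_ : i + 1 - j%:Z = i - j%:Z + 1) ?binz_succ_le; lia.
Qed.

(** Both unimodality bounds still hold at the middle of an odd row, in opposite directions. *)
Lemma diag_gf_middle (m : nat) : diag_gf (2 * m).+1 (m%:Z + 1) = diag_gf (2 * m).+1 m.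
Proof.
have h1 : coef_ge0 (diag_gf (2 * m).+1 m - diag_gf (2 * m).+1 (m%:Z + 1)).
  by apply: diag_gf_succ_le; lia.
have h2 : coef_ge0 (diag_gf (2 * m).+1 (m%:Z + 1) - diag_gf (2 * m).+1 m).
  have := @diag_gf_pred_le (2 * m).+1 (m%:Z + 1).
  by rewrite addrK; apply; lia.
apply/polyP => j; have := h1 j; have := h2 j.
by rewrite !coefB !coef_diag_gf; lia.
Qed.

(* The coefficients of q^(m+1+l) of the two terms are in fact equal, by
   sum_bin_convolution with M = 2m + 2 - 2l. *)
Lemma diag_gf_middle_le (m : nat) (i : int) : i <= m%:Z ->
  coef_ge0 ((diag_gf (2 * m).+1 i - diag_gf (2 * m).+1 (i - 2))
              * diag_gf (2 * m).+1 m
            - 'X^(m.+1) * diag_gf (2 * m).+2 (i - 1)).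
Proof.
move=> im; set h := diag_gf (2 * m).+1.
have h12 : coef_ge0 (h i - h (i - 2)).
  have -> : h i - h (i - 2) = (h i - h (i - 1)) + (h (i - 1) - h (i - 2)) by ring.
  apply: coef_ge0D; first by apply: diag_gf_pred_le; lia.
  by have -> : i - 2 = i - 1 - 1; [|apply: diag_gf_pred_le]; lia.
have hm : coef_ge0 (h m) by exact: diag_gf_ge0.
move=> k; rewrite coefB coefXnM.
have hh := coef_ge0M h12 hm.
case: ltnP => [km|mk]; first by rewrite subr0.
have [l ek] : exists l, k = (m.+1 + l)%N by exists (k - m.+1)%N; lia.
rewrite ek (_ : (m.+1 + l - m.+1)%N = l) ?coef_diag_gf; last lia.
case: (boolP (0 <= i - 1 - l%:Z)) => [li|li]; last first.
  by rewrite binz0 ?subr0 ?hh; lia.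
have [s es] : exists s : nat, i = (l.+1 + s)%N%:Z by exists `|(i - 1 - l%:Z)%R|%N; lia.
have -> : (2 * m).+2%:Z - 2 * l%:Z = (2 * m + 2 - 2 * l)%N%:Z by lia.
have -> : i - 1 - l%:Z = s%:Z by lia.
rewrite binzE -sum_bin_convolution ?subr_ge0; last lia.
pose F j := (h i - h (i - 2))`_j * (h m)`_(m.+1 + l - j).
rewrite coefM -(big_mkord xpredT F).
(* Only the range l + 1 <= j <= l + 1 + s = i matches the convolution; the terms outside it are
   nonnegative and get dropped. *)
rewrite (big_cat_nat (n := l.+1)) //=; last lia.
rewrite (big_cat_nat (m := l.+1) (n := (s.+1 + l.+1)%N)) /=; try lia.
have pos a b : 0 <= \sum_(a <= j < b) F j.
  by apply: sumr_ge0 => j _; apply: mulr_ge0.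
rewrite -[leLHS]add0r lerD ?pos // -[leLHS]addr0 lerD ?pos //.
rewrite -[X in \sum_(X <= _ < _) _](add0n l.+1) big_addn addnK big_mkord.
rewrite ler_sum // => p _; have := ltn_ord p; move: (nat_of_ord p) => {}p ps.
(* At j = p + l + 1 the factor from [h m] is C(2p+1, p), so the two sums agree term by term. *)
rewrite /F coefB !coef_diag_gf mulrC le_eqVlt; apply/orP; left; apply/eqP.
congr (_ * _).
  congr (_%:Z - _%:Z); congr (binz _ _); lia.
by rewrite -binzE; congr (binz _ _)%:Z; lia.
Qed.

(** The theorem is the case i = j, but Pascal's rule for D_(n+1)(j,j) produces D_n(j-1,j), so the
    induction must include i < j. *)
Lemma diag_gf_strong_logconcave n (i j : int) : i <= j -> 2 * j <= n%:Z ->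
  coef_ge0 (diag_gf n i * diag_gf n j - diag_gf n (i - 1) * diag_gf n (j + 1)).
Proof.
have unimodal n' (i' j' : int) : i' <= j' -> 2 * j' = n'%:Z ->
    coef_ge0 (diag_gf n' i' * diag_gf n' j'
              - diag_gf n' (i' - 1) * diag_gf n' (j' + 1)).
  move=> ij jn.
  have -> : diag_gf n' i' * diag_gf n' j' - diag_gf n' (i' - 1) * diag_gf n' (j' + 1)
    = (diag_gf n' i' - diag_gf n' (i' - 1)) * diag_gf n' j'
      + diag_gf n' (i' - 1) * (diag_gf n' j' - diag_gf n' (j' + 1)) by ring.
  apply: coef_ge0D; apply: coef_ge0M; try exact: diag_gf_ge0.
    by apply: diag_gf_pred_le; lia.
  by apply: diag_gf_succ_le; lia.
elim: n i j => [|n IH] i j ij jn.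
  have [e|ne] := eqVneq (2 * j) 0; first exact: unimodal.
  have gf0 k : k < 0 -> diag_gf 0 k = 0.
    by move=> k0; apply/polyP => l; rewrite coef_diag_gf coef0 binz0 //; lia.
  have i0 : i < 0 by lia.
  have i1 : i - 1 < 0 by lia.
  by rewrite (gf0 _ i0) (gf0 _ i1) !mul0r subrr => k; rewrite coef0.
have [e|ne] := eqVneq (2 * j) n.+1%:Z; first exact: unimodal.
(* For [i' = j] the pair (j, j-1) is out of order, but there the two products coincide. *)
have IH' i' : i' <= j ->
    coef_ge0 (diag_gf n i' * diag_gf n (j - 1) - diag_gf n (i' - 1) * diag_gf n j).
  move=> i'j; have [->|nij] := eqVneq i' j.
    by move=> k; rewrite mulrC subrr coef0.
  by have := IH i' (j - 1); rewrite subrK; apply; lia.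
have step k : k <= j -> diag_gf n.+1 k = diag_gf n k + diag_gf n (k - 1).
  by move=> kj; rewrite diag_gfS ifF ?addr0 //; lia.
have [e|ne'] := eqVneq n.+1%:Z (2 * (j + 1)); last first.
  rewrite (step i) // (step j) // (step (i - 1)); last lia.
  rewrite diag_gfS (negbTE ne') addr0 addrK.
  have -> : forall a b c d e f : {poly int},
      (a + b) * (d + e) - (b + c) * (f + d)
      = (a * d - b * f) + (a * e - b * d) + (b * d - c * f) + (b * e - c * d).
    by move=> *; ring.
  apply: coef_ge0D (coef_ge0D (coef_ge0D (IH _ _ _ _) (IH' _ _)) (IH _ _ _ _)) (IH' _ _); lia.
have [m ej] : exists m : nat, j = m by exists `|j|%N; lia.
have en : n = (2 * m).+1 by lia.
have mid : diag_gf n (j + 1) = diag_gf n j by rewrite en ej diag_gf_middle.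
have := @diag_gf_middle_le m i; rewrite -en -ej => /(_ ij) main.
have im : diag_gf n.+1 (i - 1) = diag_gf n (i - 1) + diag_gf n (i - 2).
  by rewrite step; [congr (_ + diag_gf _ _)|]; lia.
rewrite (diag_gfS n (j + 1)) e eqxx addrK mid (_ : `|(j + 1)%R|%N = m.+1); last lia.
rewrite (step i) // (step j) // im; rewrite im in main.
(* Here [f] is the extra ['X^(m.+1)]. As f_(n,j+1) = f_(n,j) = [d], the sum D_n(i,j) + D_n(i-1,j)
   collapses to [(a - c) * d], which absorbs the extra term by [main]. *)
have -> : forall a b c d e f : {poly int},
    (a + b) * (d + e) - (b + c) * (d + d + f)
    = (a * e - b * d) + (b * e - c * d) + ((a - c) * d - f * (b + c)).
  by move=> *; ring.
rewrite (_ : i - 2 = i - 1 - 1) in main *; last lia.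
apply: coef_ge0D (coef_ge0D (IH' _ _) (IH' _ _)) main; lia.
Qed.

Local Close Scope ring_scope.

Theorem theorem4p3 (n i : nat) (hi : i <= n./2) (r : nat) :
  \sum_(0 <= j < i.+1) \sum_(0 <= k < i.+1 | j + k == r)
     binz (n%:Z - 2%:Z * j%:Z)%R (i%:Z - j%:Z)%R
       * binz (n%:Z - 2%:Z * k%:Z)%R (i%:Z - k%:Z)%R
  >= \sum_(0 <= j < i.+2) \sum_(0 <= k < i.+2 | j + k == r)
     binz (n%:Z - 2%:Z * j%:Z)%R (i%:Z - 1 - j%:Z)%R
       * binz (n%:Z - 2%:Z * k%:Z)%R (i%:Z + 1 - k%:Z)%R.
Proof.
have cast N (A B : nat -> nat) :
    Posz (\sum_(0 <= j < N) \sum_(0 <= k < N | j + k == r) A j * B k)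
    = ((\poly_(j < N) (A j)%:Z * \poly_(k < N) (B k)%:Z)`_r)%R.
  rewrite coefM_poly (big_morph Posz PoszD (erefl _)); apply: eq_bigr => j _.
  rewrite (big_morph Posz PoszD (erefl _)); apply: eq_bigr => k _.
  by rewrite PoszM.
have hn : (2 * i%:Z <= n%:Z)%R by lia.
have := diag_gf_strong_logconcave (lexx _) hn r.
rewrite -lez_nat !cast coefB subr_ge0.
rewrite (@diag_gf_poly n i i.+1) ?ltz_nat //.
(* The common range [i.+2] exceeds both indices i - 1 and i + 1. *)
rewrite (@diag_gf_poly n (_ - 1)%R i.+2) ?(@diag_gf_poly n (_ + 1)%R i.+2) //; lia.
Qed.
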